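(* Every compact Hausdorff space $K$ which is countable satisfies condition (B).
   Context: $C(K)$ is the Banach space of all scalar-valued (real or complex) continuous functions on $K$ with the supremum norm. The support $\mathrm{supp}(f)$ of $f\in C(K)$ is the closure of $\{x\in K\colon f(x)\neq 0\}$. For $f,g\in C(K)$ write $f\prec g$ if $f\neq g$ and $f(x)=g(x)$ for every $x\in\mathrm{supp}(f)$; this is a strict (partial) ordering on $C(K)$. A $\prec$-chain is a subset of $C(K)$ any two distinct elements of which are comparable under $\prec$. A compact Hausdorff space $K$ satisfies condition (B) if for each uncountable $\prec$-chain $F$ in $C(K)$ with $\sup_{f\in F}\|f\|<\infty$ one has $\inf\{\|f-g\|\colon f,g\in F,\ f\neq g\}=0$; equivalently, for each $\delta>0$ there is no uncountable uniformly bounded $\prec$-chain in $C(K)$ whose distinct elements are at distance at least $\delta$ from each other. *)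

(* Defs.v *)
From HB Require Import structures.
From mathcomp Require Import all_boot all_order all_algebra.
From mathcomp Require Import complex.
From mathcomp Require Import all_classical all_reals all_analysis.

Set Implicit Arguments.
Unset Strict Implicit.
Unset Printing Implicit Defensive.

Import Order.TTheory GRing.Theory Num.Theory.
Import numFieldNormedType.Exports.

Local Open Scope classical_set_scope.
Local Open Scope ring_scope.

(* Rcomplex R is the alias of R[i] on which real-closed puts the R-vector space
   structure and the R-valued modulus (whereas the norm of R[i] is R[i]-valued).
   It has no topology there: we give it the one induced by the modulus, so that
   real and complex scalars are both instances of normedModType R. *)
Section complex_normed_space.
Variable R : realType.

HB.instance Definition _ :=
  PseudoMetric.copy (Rcomplex R) (pseudoMetric_normed (Rcomplex R)).

HB.instance Definition _ := isPointed.Build (Rcomplex R) 0.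

HB.instance Definition _ :=
  NormedZmod_PseudoMetric_eq.Build R (Rcomplex R) erefl.

Fact Rcomplex_normrZ (l : R) (z : Rcomplex R) : `|l *: z| = `|l| * `|z|.
Proof.
case: z => a b.
change (Num.sqrt ((l * a) ^+ 2 + (l * b) ^+ 2) =
        `|l| * Num.sqrt (a ^+ 2 + b ^+ 2)).
by rewrite !exprMn -mulrDr sqrtrM ?sqr_ge0// sqrtr_sqr.
Qed.

HB.instance Definition _ :=
  PseudoMetricNormedZmod_Lmodule_isNormedModule.Build R (Rcomplex R)
    Rcomplex_normrZ.

End complex_normed_space.

(* V stands for the scalar field, either R or Rcomplex R, and
   continuousType K V for the underlying set of C(K). *)
Section condition_B.
Context {R : realType} {V : normedModType R} {K : topologicalType}.
Implicit Types f g : continuousType K V.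

Definition supp f : set K := closure [set x | f x <> 0].

Definition prec f g : Prop := f <> g /\ (forall x, supp f x -> f x = g x).

Definition prec_chain (F : set (continuousType K V)) : Prop :=
  forall f g, F f -> F g -> f <> g -> prec f g \/ prec g f.

(* For compact K and continuous h the supremum is that of a bounded set; it is
   0 when K is empty (sup set0 = 0). *)
Definition supnorm (h : K -> V) : R := sup (range (fun x => `|h x|)).

End condition_B.

(* The supremum and infimum over F are taken in the extended reals. *)
Definition condition_B {R : realType} (V : normedModType R)
    (K : topologicalType) : Prop :=
  forall F : set (continuousType K V),
    ~ countable F -> prec_chain F ->
    (ereal_sup [set (supnorm f)%:E | f in F] < +oo)%E ->
    ereal_inf [set d | exists f g, [/\ F f, F g, f <> g &
                         d = (supnorm (fun x => f x - g x))%:E]] = 0%E.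

(* Main.v *)
Require Import Defs.
From HB Require Import structures.
From mathcomp Require Import all_boot all_order all_algebra.
From mathcomp Require Import complex finmap.
From mathcomp Require Import all_classical all_reals all_analysis.
Import numFieldNormedType.Exports.
Local Open Scope classical_set_scope.

(** Suppose that the infimum of the distances is positive.  Then there is [d > 0]
    such that any two distinct elements of the chain [F] differ by at least [d]
    at some point ([supnorm_ge_witness]).  To [f] in [F] attach the compact level set
    [A f = {x | d <= |f x|}].  If [f] precedes [g], then [g] agrees with [f] on
    [supp f] and is therefore [d]-far from [f] at some point where [f]
    vanishes ([prec_separated_witness]).  Two consequences follow.

    - On the one hand, [f] is determined by [A f], and for [f] preceding [g]
      the set [A f] is the trace on [A g] of the open set [{f <> 0}]: it is
      clopen in [A g].  A countable Hausdorff space has a countable family of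
      sets separating all pairs of disjoint compact sets
      ([countable_compact_separation]), so [A g] has only countably many clopen
      subsets.  Hence every [g] in [F] has countably many predecessors in [F]
      ([countable_predecessors]).
    - On the other hand, for each point [x] covered by the sets [A f], choose
      [h x] in [F] with [x] in [A (h x)].  At most one element of [F] precedes
      none of the [h x]: the larger of two such elements would have a point [x]
      in its level set where the smaller one vanishes, while the smaller one,
      not preceding [h x], must take the nonzero value [h x x] there.

    So [F] is covered by the predecessors of countably many elements and one
    further element, and is countable ([countable_separated_chain]).  The
    argument works for functions with values in any normed module. *)

Import Order.TTheory GRing.Theory Num.Theory.
Local Open Scope ring_scope.

(** * Separating compact sets by countably many sets *)

Lemma open_bigcap_fset (T : topologicalType) (I : choiceType) (D : {fset I})
    (f : I -> set T) :
  (forall i, i \in D -> open (f i)) -> open (\bigcap_(i in [set` D]) f i).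
Proof.
move=> fo; rewrite openE => x fx; apply: filter_bigI => i iD.
by apply: open_nbhs_nbhs; split; [exact: fo|exact: fx].
Qed.

(** A point of [A] turns the space into a pointed one, where compactness and
    the covering property are equivalent by [compact_cover]. *)
Lemma compact_cover_compact (T : topologicalType) (A : set T) :
  compact A -> cover_compact A.
Proof.
have [-> _ I D f _ _|/set0P[x _] cA] := eqVneq A set0.
  by exists fset0 => //; exact: sub0set.
pose pT : ptopologicalType :=
  HB.pack_for ptopologicalType T (isPointed.Build T x).
by change (@cover_compact pT A); rewrite -(@compact_cover pT).
Qed.

(** The usual two-step compactness argument: a point is separated from a
    compact set by a finite intersection of the open sets that witness the
    Hausdorff axiom, and a compact set by a finite union of those.  Over a
    countable space there are countably many witnesses, hence countably many
    such finite combinations. *)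
Lemma countable_compact_separation (K : topologicalType) :
  hausdorff_space K -> countable [set: K] ->
  exists2 S : set (set K), countable S &
    forall C D : set K, compact C -> compact D -> C `&` D = set0 ->
    exists2 W, S W & C `<=` W /\ W `&` D = set0.
Proof.
move=> hK cK.
have sepK (p : K * K) : exists AB : set K * set K, p.1 != p.2 ->
    [/\ open AB.1, open AB.2, AB.1 p.1, AB.2 p.2 & AB.1 `&` AB.2 = set0].
  have [e|ne] := eqVneq p.1 p.2; first by exists (set0, set0).
  move: hK; rewrite open_hausdorff => /(_ _ _ ne)[AB [xA yB] [oA oB /eqP AB0]].
  by exists AB => _; split=> //; rewrite -inE.
have [P sepP] := choice sepK.
pose U : set (set K) := [set (P p).1 | p in [set: K * K]].
have cU : countable U.
  apply: (sub_countable (card_image_le _ _)).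
  by rewrite -setXTT; exact: countableX.
pose V : set (set K) := finI_from U id.
have cV : countable V by exact: finI_from_countable.
exists [set \bigcup_(v in [set` E]) v | E in
    [set E : {fset set K} | {subset E <= V}]].
  apply: (sub_countable (card_image_le _ _)).
  exact: fset_subset_countable.
move=> C D cC cD CD0.
have sep_point x : C x -> exists v, [/\ V v, open v, v x & v `&` D = set0].
  move=> Cx.
  have nex y : D y -> x != y.
    move=> Dy; apply/eqP => xy.
    have : (C `&` D) x by split=> //; rewrite xy.
    by rewrite CD0.
  have := compact_cover_compact _ _ cD => /(_ K D (fun y => (P (x, y)).2)) [].
  - by move=> y Dy; case: (sepP (x, y) (nex y Dy)).
  - by move=> y Dy; exists y => //; case: (sepP (x, y) (nex y Dy)).
  move=> D' D'D covD.
  have D'ne y : y \in D' -> x != y by move=> /D'D; rewrite inE; exact: nex.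
  exists (\bigcap_(y in [set` D']) (P (x, y)).1); split.
  - exists [fset (P (x, y)).1 | y in D']%fset.
      by move=> /= _ /imfsetP[y _ ->]; rewrite inE; exists (x, y).
    apply/seteqP; split=> z zE.
      by move=> y yD'; apply: zE; apply/imfsetP; exists y.
    by move=> _ /imfsetP[y yD' ->]; exact: zE.
  - apply: open_bigcap_fset => y /D'ne ne.
    by case: (sepP (x, y) ne).
  - by move=> y /D'ne ne; case: (sepP (x, y) ne).
  - apply/seteqP; split=> // z [zE /covD[y yD' zy]].
    case: (sepP (x, y) (D'ne _ yD')) => _ _ _ _ <-.
    by split=> //; exact: zE.
have := compact_cover_compact _ _ cC.
move=> /(_ (set K) [set v | [/\ V v, open v & v `&` D = set0]] id) [].
- by move=> v [].
- by move=> x /sep_point[v [Vv vo vx vD]]; exists v.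
move=> E EV covC; exists (\bigcup_(v in [set` E]) v).
  by exists E => // v /EV; rewrite !inE => -[].
split=> //; apply/seteqP; split=> // z [[v vE vz] Dz].
by move: (EV v vE); rewrite inE => -[_ _ <-].
Qed.

(** * Chains with a positive separation *)

Section separated_chain.
Context {R : realType} {V : normedModType R} {K : topologicalType}.
Variables (F : set (continuousType K V)) (d : R).
Hypotheses (d0 : 0 < d) (Fchain : prec_chain F).
Hypothesis Fsep : forall f g, F f -> F g -> f <> g ->
  exists x, d <= `|f x - g x|.
Implicit Types f g : continuousType K V.

Definition level f : set K := [set x | d <= `|f x|].

Lemma level_neq0 f x : level f x -> f x <> 0.
Proof. by rewrite /level /= => + fx0; rewrite fx0 normr0 leNgt d0. Qed.

Lemma prec_eq f g x : prec f g -> f x <> 0 -> g x = f x.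
Proof. by move=> [_ e] fx; rewrite e//; exact: subset_closure. Qed.

Lemma prec_separated_witness f g : F f -> F g -> prec f g ->
  exists2 x, level g x & f x = 0.
Proof.
move=> Ff Fg fg; have [x dx] := Fsep _ _ Ff Fg fg.1.
have fx0 : f x = 0.
  apply: contrapT => /(prec_eq _ _ _ fg) gx.
  by move: dx; rewrite gx subrr normr0 leNgt d0.
by exists x => //; move: dx; rewrite fx0 sub0r normrN.
Qed.

(** The larger of two distinct functions of the chain is large at
    some point where the smaller one vanishes, so their level sets differ. *)
Lemma level_inj f g : F f -> F g -> level f = level g -> f = g.
Proof.
move=> Ff Fg fg; apply: contrapT => ne.
case: (Fchain _ _ Ff Fg ne).
- by move=> /(prec_separated_witness _ _ Ff Fg)[x]; rewrite -fg => /level_neq0.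
- by move=> /(prec_separated_witness _ _ Fg Ff)[x]; rewrite fg => /level_neq0.
Qed.

Hypotheses (compK : compact [set: K]) (hK : hausdorff_space K).
Hypothesis cK : countable [set: K].

Lemma closed_level f : closed (level f).
Proof.
have -> : level f = (fun x => `|f x|) @^-1` [set y | d <= y] by [].
apply: preimage_closed; last exact: closed_ge.
move=> x _; apply: continuous_comp; first exact: cts_fun.
exact: norm_continuous.
Qed.

(** For [f] preceding [g], this set is the complement of [level f] in [level g]
    ([prec_levelE]); its being closed is what makes [level f] clopen there. *)
Lemma closed_level_zeros f g : closed (level g `&` [set x | f x = 0]).
Proof.
apply: closedI; first exact: closed_level.
have -> : [set x | f x = 0] = f @^-1` [set 0] by [].
apply: preimage_closed; first by move=> x _; exact: cts_fun.
by apply: accessible_closed_set1; apply: hausdorff_accessible;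
  exact: norm_hausdorff.
Qed.

Lemma prec_levelE f g (W : set K) : prec f g -> level f `<=` W ->
  W `&` (level g `&` [set x | f x = 0]) = set0 -> level f = level g `&` W.
Proof.
move=> fg fW W0; apply/seteqP; split=> x.
  move=> lx; split; last exact: fW.
  by rewrite /level /= (prec_eq _ _ _ fg)//; exact: level_neq0.
move=> [lx Wx].
have [fx|fx] := pselect (f x = 0).
  by suff : set0 x by []; rewrite -W0.
by rewrite /level /= -(prec_eq _ _ _ fg fx).
Qed.

(** Each predecessor [f] of [g] is coded by a member [w f] of the countable
    separating family: [level g `&` w f] recovers [level f], hence [f]. *)
Lemma countable_predecessors g : F g ->
  countable [set f | F f /\ prec f g].
Proof.
move=> Fg; have [S cS sepS] := countable_compact_separation K hK cK.
have cpt (A : set K) : closed A -> compact A.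
  by move=> cA; exact: subclosed_compact cA compK (@subsetT _ A).
have codes f : exists W, prec f g -> S W /\ level f = level g `&` W.
  have [fg|nfg] := pselect (prec f g); last by exists set0.
  have [|W SW [fW W0]] := sepS _ _ (cpt _ (closed_level f))
      (cpt _ (closed_level_zeros f g)).
    by apply/seteqP; split=> // x [/level_neq0 fx [_ /fx]].
  by exists W => _; split=> //; exact: prec_levelE.
have [w wP] := choice codes.
apply: (sub_countable _ cS).
have /inj_card_eq : {in [set f | F f /\ prec f g] &, injective w}.
  move=> f f' /[!inE] -[Ff fg] [Ff' f'g] ww.
  apply: level_inj => //.
  by rewrite (wP _ fg).2 (wP _ f'g).2 ww.
move=> /card_eqPle[_ le]; apply: (card_le_trans le).
by apply: subset_card_le => _ [f [_ fg] <-]; exact: (wP _ fg).1.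
Qed.

Lemma countable_separated_chain : countable F.
Proof.
have [->|/set0P[f0 _]] := eqVneq F set0; first exact: countable0.
pose T := [set x | exists2 f, F f & level f x].
have hT x : exists h : continuousType K V, T x -> F h /\ level h x.
  have [[f Ff fx]|nT] := pselect (T x); first by exists f.
  by exists f0.
have [h hP] := choice hT.
pose M := [set f | F f /\ forall x, T x -> ~ prec f (h x)].
have M_no_prec f g : M f -> M g -> ~ prec f g.
  move=> [Ff Mf] [Fg _] fg.
  have [x gx fx0] := prec_separated_witness _ _ Ff Fg fg.
  have Tx : T x by exists g.
  have [Fh hx] := hP _ Tx.
  (* As [f] does not precede [h x], it is [h x] or larger, so that
     [f x = h x x <> 0]. *)
  have [fh|nfh] := pselect (f = h x).
    by apply: (level_neq0 _ _ hx); rewrite -fh.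
  have [|hf] := Fchain _ _ Ff Fh nfh; first exact: Mf.
  apply: (level_neq0 _ _ hx).
  by rewrite -(prec_eq _ _ _ hf)//; exact: level_neq0.
have M_le1 f g : M f -> M g -> f = g.
  move=> Mf Mg; apply: contrapT => ne.
  by case: (Fchain _ _ Mf.1 Mg.1 ne); exact: M_no_prec.
have cM : countable M.
  by apply/countable_injP; exists (fun=> 0%N) => f g /[!inE] Mf Mg _;
    exact: M_le1.
suff FE : F `<=` \bigcup_(x in T) [set f | F f /\ prec f (h x)] `|` M.
  apply: (sub_countable (subset_card_le FE)).
  rewrite -bigcup2E; apply: bigcup_countable => // -[|[|n]] _ //=.
  apply: bigcup_countable; first exact: sub_countable (subset_card_le _) cK.
  by move=> x Tx; apply: countable_predecessors; exact: (hP _ Tx).1.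
move=> f Ff; have [[x Tx fx]|nex] := pselect (exists2 x, T x & prec f (h x)).
  by left; exists x.
by right; split=> // x Tx fx; apply: nex; exists x.
Qed.

End separated_chain.

Lemma supnorm_ge0 (R : realType) (V : normedModType R) (K : topologicalType)
  (u : K -> V) : 0 <= supnorm u.
Proof.
rewrite /supnorm; set E := (X in sup X).
have [supE|/sup_out->//] := pselect (has_sup E).
have [[y Ey] _] := supE; apply: (@le_trans _ _ y);
  last exact: sup_upper_bound supE _ Ey.
by case: Ey => x _ <-; exact: normr_ge0.
Qed.

(** A bound strictly below the supremum is exceeded somewhere, whether or not
    the supremum is attained.  On an empty domain the supremum is [0], against
    the hypotheses. *)
Lemma supnorm_ge_witness (R : realType) (V : normedModType R)
    (K : topologicalType) (u : K -> V) (d : R) :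
  0 < d -> d <= supnorm u -> exists x, d / 2 <= `|u x|.
Proof.
move=> d0 du; apply: contrapT => nex.
have u_lt x : `|u x| < d / 2.
  by rewrite ltNge; apply/negP => ux; apply: nex; exists x.
have : supnorm u <= d / 2.
  rewrite /supnorm; have [->|ne] := eqVneq (range (fun x => `|u x|)) set0.
    by rewrite sup0 ltW// divr_gt0.
  apply: ge_sup; first exact/set0P.
  by move=> _ [x _ <-]; exact: ltW.
by move=> /(le_trans du); rewrite leNgt gtr_pMr// invf_lt1// ltr1n.
Qed.

(** If the infimum of the distances were positive, the chain would be separated
    by some real [d > 0], hence countable. *)
Lemma condition_B_countable (R : realType) (V : normedModType R)
    (K : topologicalType) :
  compact [set: K] -> hausdorff_space K -> countable [set: K] ->
  condition_B V K.
Proof.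
move=> compK hK cK F ncF Fchain _.
set D := [set e | _].
have D_ge0 : (0 <= ereal_inf D)%E.
  apply: le_ereal_inf_tmp => _ [f [g [_ _ _ ->]]]; rewrite lee_fin.
  exact: supnorm_ge0.
apply/eqP; rewrite eq_le D_ge0 andbT leNgt; apply/negP => D_gt0.
have [d d0 dD] : exists2 d : R, 0 < d & (d%:E <= ereal_inf D)%E.
  case: (ereal_inf D) D_gt0 => [r|_|//].
    by rewrite lte_fin => r0; exists r.
  by exists 1 => //; exact: leey.
apply: ncF; apply: (@countable_separated_chain R V K F (d / 2)) => //.
  by rewrite divr_gt0.
move=> f g Ff Fg fg.
apply: (@supnorm_ge_witness R V K (fun x => f x - g x)) => //.
rewrite -lee_fin; apply: (le_trans dD).
by apply: ereal_inf_lbound; exists f, g.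
Qed.

Theorem corollary3p2 (R : realType) (K : topologicalType) :
  compact [set: K] -> hausdorff_space K -> countable [set: K] ->
  condition_B R K /\ condition_B (Rcomplex R) K.
Proof. by move=> compK hK cK; split; exact: condition_B_countable. Qed.
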